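(* Let $r\geq 3$ be an integer and let $T$ be a (finite) nonabelian simple group generated by two elements $a$ and $b$ such that $|a|=2$, $|b|\geq 3$, and the orders $|ab|$ and $|ba|$ are different from both $|a|$ and $|b|$. Consider $T\wr S_{2r}$ with $S_{2r}$ acting by permuting the $2r$ simple direct factors of $N:=T^{2r}$. Let $$\varphi:=(1,2r)(2,2r-1)(3,2r-2)\cdots(r,r+1),\qquad \sigma:=(1,2,3,\dots,r)(r+1,r+2,\dots,2r)$$ in $S_{2r}$, so that $\varphi^2=\sigma^r=1$ and $\sigma^\varphi=\sigma^{-1}$. Let $n:=(a,b,1,\dots,1,b,a)\in T^{2r}$, that is, the entries of $n$ in positions $1,2,2r-1,2r$ are $a,b,b,a$ respectively and all other entries are the identity. Let $G:=N\rtimes\langle\sigma,\varphi\rangle\leq T\wr S_{2r}$, so that $G\cong T^{2r}\rtimes D_r$. Let $s:=\varphi$, $g:=n\sigma$, $S:=\langle s\rangle$ and $\Gamma:=\mathrm{Cos}(G,S,g)$. Then the following hold: (a) $(\Gamma,G)\in\mathcal{OG}(4)$; (b) $(\Gamma,G)$ is basic of unoriented-cycle type.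
   Context: All groups and graphs are finite; graphs are simple and undirected. Permutations act on the right, and for $m\in T^{2r}$ and $x\in S_{2r}$, $m^x=x^{-1}mx$ is the tuple whose entry in position $i^x$ is the entry of $m$ in position $i$. For a group $G$, a proper subgroup $S<G$ and $g\in G\setminus S$, the coset graph $\mathrm{Cos}(G,S,g)$ has vertex set $\{Sx: x\in G\}$, with $\{Sx,Sy\}$ an edge iff $xy^{-1}\in SgS$ or $yx^{-1}\in SgS$; $G$ acts on it by right multiplication, and $(\Gamma,G)$ refers to this action (so $(\Gamma,G)\in\mathcal{OG}(4)$ includes that the action is faithful). For $G\le \mathrm{Aut}(\Gamma)$, $\Gamma$ is $G$-oriented if $G$ is transitive on the vertices and on the edges of $\Gamma$ but not on the arcs (ordered pairs of adjacent vertices). $\mathcal{OG}(4)$ is the set of pairs $(\Gamma,G)$ with $\Gamma$ a connected $4$-valent graph, $G\leq \mathrm{Aut}(\Gamma)$, and $\Gamma$ $G$-oriented. For $N\unlhd G$, the $G$-normal quotient $\Gamma_N$ is the graph whose vertices are the $N$-orbits on $V\Gamma$, two distinct $N$-orbits being adjacent iff there is an edge of $\Gamma$ between a vertex of one and a vertex of the other. $\tilde N$ denotes the kernel of the action of $G$ on the set of $N$-orbits. $\mathbf{C}_m$ ($m\ge 3$) is the cycle graph with $m$ vertices. $(\Gamma,G)\in\mathcal{OG}(4)$ is basic if $\Gamma_N$ is isomorphic to $K_1$, $K_2$ or some $\mathbf{C}_m$ ($m\geq 3$) for every nontrivial normal subgroup $N$ of $G$. A cyclic normal quotient is a $\Gamma_N$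 isomorphic to some $\mathbf{C}_m$, $m\ge3$; it is $G$-oriented if $G/\tilde N\cong C_m$ (cyclic of order $m$) and $G$-unoriented if $G/\tilde N\cong D_m$ (dihedral of order $2m$). Two cyclic normal quotients $\Gamma_M,\Gamma_N$ are independent if $\Gamma_K$, with $K=\tilde M\cap\tilde N$, is not a cycle. $(\Gamma,G)$ is basic of unoriented-cycle type if it is basic, has at least one cyclic normal quotient, has no independent cyclic normal quotients, and all its cyclic normal quotients are $G$-unoriented. *)

(* Defs.v *)
From HB Require Import structures.
From mathcomp Require Import all_boot all_fingroup all_solvable.
From mathcomp Require Import zify.

Set Implicit Arguments.
Unset Strict Implicit.
Unset Printing Implicit Defensive.

Import GroupScope.

(* A graph is a vertex set inside a finite type together with an adjacency    *)
(* relation.  That the graph is simple is not built in: it is the predicate   *)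
(* simple_graph below, which is part of membership in OG(4).                  *)
Record graph (V : finType) := Graph { vset : {set V}; adj : rel V }.

Definition simple_graph (V : finType) (X : graph V) : Prop :=
  [/\ forall x y, adj X x y -> (x \in vset X) && (y \in vset X),
      symmetric (adj X) & irreflexive (adj X)].

Definition edges (V : finType) (X : graph V) : {set {set V}} :=
  [set [set x; y] | x in vset X, y in vset X & adj X x y].

Definition arcs (V : finType) (X : graph V) : {set 2.-tuple V} :=
  [set [tuple x; y] | x in vset X, y in vset X & adj X x y].

Definition connected (V : finType) (X : graph V) : Prop :=
  {in vset X &, forall x y, connect (adj X) x y}.

Definition regular (V : finType) (k : nat) (X : graph V) : Prop :=
  forall x, x \in vset X -> #|[set y in vset X | adj X x y]| = k.

Definition graph_iso (V W : finType) (X : graph V) (Y : graph W) : Prop :=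
  exists f : V -> W,
    [/\ {in vset X &, injective f}, f @: vset X = vset Y
      & {in vset X &, {mono f : x y / adj X x y >-> adj Y x y}}].

Definition complete_graph (n : nat) : graph 'I_n :=
  Graph [set: 'I_n] (fun i j => i != j).

(* ordS i is i + 1 modulo m; used only for m >= 3. *)
Definition cycle_graph (m : nat) : graph 'I_m :=
  Graph [set: 'I_m] (fun i j => (j == ordS i) || (i == ordS j)).

Definition is_cycle (V : finType) (X : graph V) : Prop :=
  exists2 m, 3 <= m & graph_iso X (cycle_graph m).

(* G acts faithfully by automorphisms, that is, G <= Aut X. *)
Definition acts_as_auts (aT : finGroupType) (V : finType)
    (to : {action aT &-> V}) (G : {set aT}) (X : graph V) : Prop :=
  [/\ [acts G, on vset X | to], [faithful G, on vset X | to]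
    & forall a, a \in G ->
        {in vset X &, {mono to^~ a : x y / adj X x y}}].

Definition oriented (aT : finGroupType) (V : finType)
    (to : {action aT &-> V}) (G : {set aT}) (X : graph V) : Prop :=
  [/\ [transitive G, on vset X | to], [transitive G, on edges X | to^*]
    & ~~ [transitive G, on arcs X | to * 2]].

Definition OG4 (aT : finGroupType) (V : finType)
    (to : {action aT &-> V}) (X : graph V) (G : {set aT}) : Prop :=
  [/\ simple_graph X, connected X, regular 4 X,
      acts_as_auts to G X & oriented to G X].

Definition normal_quotient (aT : finGroupType) (V : finType)
    (to : {action aT &-> V}) (X : graph V) (N : {set aT}) : graph {set V} :=
  let orbs := orbit to N @: vset X in
  Graph orbs (fun A B => [&& A \in orbs, B \in orbs, A != B
                           & [exists x in A, exists y in B, adj X x y]]).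

(* The kernel of the action of G on the set of N-orbits. *)
Definition orbits_kernel (aT : finGroupType) (V : finType)
    (to : {action aT &-> V}) (X : graph V) (G N : {set aT}) : {set aT} :=
  'C_G(orbit to N @: vset X | to^*).

(* basic and basic_unoriented_cycle_type are meant for pairs (X, G) in OG(4),  *)
(* a condition they do not repeat.                                            *)
Definition basic (aT : finGroupType) (V : finType)
    (to : {action aT &-> V}) (X : graph V) (G : {set aT}) : Prop :=
  forall N : {group aT}, N <| G -> N :!=: 1 ->
    let XN := normal_quotient to X N in
    [\/ graph_iso XN (complete_graph 1), graph_iso XN (complete_graph 2)
      | is_cycle XN].

Definition cyclic_quotient (aT : finGroupType) (V : finType)
    (to : {action aT &-> V}) (X : graph V) (G N : {set aT}) : Prop :=
  N <| G /\ is_cycle (normal_quotient to X N).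

(* 'D_(m.*2) is the dihedral group of order 2m. *)
Definition unoriented_quotient (aT : finGroupType) (V : finType)
    (to : {action aT &-> V}) (X : graph V) (G N : {set aT}) : Prop :=
  exists m, [/\ 3 <= m, graph_iso (normal_quotient to X N) (cycle_graph m)
              & G / orbits_kernel to X G N \isog 'D_(m.*2)].

Definition independent_quotients (aT : finGroupType) (V : finType)
    (to : {action aT &-> V}) (X : graph V) (G M N : {set aT}) : Prop :=
  ~ is_cycle (normal_quotient to X
                (orbits_kernel to X G M :&: orbits_kernel to X G N)).

Definition basic_unoriented_cycle_type (aT : finGroupType) (V : finType)
    (to : {action aT &-> V}) (X : graph V) (G : {set aT}) : Prop :=
  [/\ basic to X G,
      exists N : {group aT}, cyclic_quotient to X G N,
      ~ exists M N : {group aT},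
          [/\ cyclic_quotient to X G M, cyclic_quotient to X G N
            & independent_quotients to X G M N]
    & forall N : {group aT}, cyclic_quotient to X G N ->
        unoriented_quotient to X G N].

Definition coset_graph (gT : finGroupType) (G S : {set gT}) (g : gT) :
    graph {set gT} :=
  let SgS := (S :* g) * S in
  Graph (rcosets S G)
    (fun A B => [exists x in G, exists y in G,
       [&& A == S :* x, B == S :* y
         & (x * y^-1 \in SgS) || (y * x^-1 \in SgS)]]).

Section Wreath.

Variables (T : finGroupType) (k : nat).

Local Notation base := {dffun forall i : 'I_k, T}.

(* The entry of m in position i is moved to position x i. *)
Definition base_act (m : base) (x : 'S_k) : base := [ffun j => m (x^-1 j)].

Lemma base_act_is_action : is_action [set: 'S_k] base_act.
Proof.
apply: is_total_action => [m | m x y].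
  by apply/ffunP=> j; rewrite ffunE invg1 perm1.
by apply/ffunP=> j; rewrite !ffunE invMg permM.
Qed.

Canonical base_action := Action base_act_is_action.

Lemma base_act_is_groupAction : is_groupAction [set: base] base_action.
Proof.
move=> x _; rewrite /= inE; apply/andP; split.
  by apply/subsetP=> m _; rewrite inE.
apply/morphicP=> m1 m2 _ _; rewrite !actpermE /=.
by apply/ffunP=> j; rewrite !ffunE.
Qed.

Canonical base_groupAction := GroupAction base_act_is_groupAction.

Definition wreath : finGroupType :=
  @sdprod_by _ _ [set: 'S_k]%G [set: base]%G base_groupAction.

Definition wr_base (m : base) : wreath := sdpair1 base_groupAction m.
Definition wr_perm (x : 'S_k) : wreath := sdpair2 base_groupAction x.

End Wreath.

(* Positions 1, ..., 2r are represented by 0, ..., 2r - 1 in 'I_(r + r). *)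

Definition phi (r : nat) : 'S_(r + r) := perm (@rev_ord_inj (r + r)).

Definition sigma_fun (r : nat) (i : 'I_(r + r)) : 'I_(r + r) :=
  match split i with
  | inl j => lshift r (ordS j)
  | inr j => rshift r (ordS j)
  end.

Lemma sigma_fun_inj (r : nat) : injective (@sigma_fun r).
Proof.
move=> i j; rewrite /sigma_fun.
case: (split_ordP i) => i' ->; case: (split_ordP j) => j' -> /eqP;
  rewrite ?eq_shift // => /eqP /ordS_inj -> //.
Qed.

Definition sigma (r : nat) : 'S_(r + r) := perm (@sigma_fun_inj r).

Definition ntuple (T : finGroupType) (r : nat) (a b : T) :
    {dffun forall i : 'I_(r + r), T} :=
  [ffun i => if nat_of_ord i \in [:: 0; (r + r).-1]%N then a
             else if nat_of_ord i \in [:: 1; (r + r).-2]%N then b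
             else 1].

(* The embedded copies of N = T^(2r) and of <sigma, phi> in T wr S_2r, and    *)
(* the subgroup G that they generate; lemma grpG_sdprod below shows that G is *)
(* their internal semidirect product.                                         *)
Definition grpN (T : finGroupType) (r : nat) : {group wreath T (r + r)} :=
  (sdpair1 (base_groupAction T (r + r)) @* setT)%G.

Definition grpD (T : finGroupType) (r : nat) : {group wreath T (r + r)} :=
  <<[set wr_perm T (sigma r); wr_perm T (phi r)]>>%G.

Definition grpG (T : finGroupType) (r : nat) : {group wreath T (r + r)} :=
  (grpN T r <*> grpD T r)%G.

Lemma grpG_sdprod (T : finGroupType) (r : nat) :
  grpN T r ><| grpD T r = grpG T r.
Proof.
have sD : grpD T r \subset
    sdpair2 (base_groupAction T (r + r)) @* [set: 'S_(r + r)].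
  rewrite gen_subG; apply/subsetP=> _ /set2P[] ->;
    by rewrite mem_morphim ?inE.
rewrite sdprodEY //; first exact: subset_trans sD (im_sdpair_norm _).
by apply/trivgP; rewrite -(im_sdpair_TI (base_groupAction T (r + r))) setIS.
Qed.

Section CosetData.

Variables (T : finGroupType) (r : nat) (a b : T).

Definition elt_s : wreath T (r + r) := wr_perm T (phi r).

Definition elt_g : wreath T (r + r) :=
  wr_base (ntuple r a b) * wr_perm T (sigma r).

Definition grpS : {group wreath T (r + r)} := <[elt_s]>%G.

Definition Gamma : graph {set wreath T (r + r)} :=
  coset_graph (grpG T r) grpS elt_g.

End CosetData.

Lemma phi2 (r : nat) : phi r ^+ 2 = 1.
Proof. by apply/permP=> i; rewrite expgS expg1 permM !permE rev_ordK. Qed.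

Lemma sigmaXr (r : nat) : sigma r ^+ r = 1.
Proof.
apply/permP=> i; rewrite permX perm1.
suff it m : m <= r -> iter m (sigma r) i =
    match split i with
    | inl j => lshift r (iter m (@ordS r) j)
    | inr j => rshift r (iter m (@ordS r) j) end.
  have ordSr (j : 'I_r) : iter r (@ordS r) j = j.
    apply: val_inj => /=.
    have E m : val (iter m (@ordS r) j) = (j + m) %% r.
      elim: m => [|m /= ->] /=; first by rewrite addn0 modn_small.
      by rewrite -addn1 modnDml addn1 addnS.
    by rewrite E modnDr modn_small.
  rewrite it // -[RHS](splitK i) /unsplit.
  by case: (split i) => j; rewrite ordSr.
elim: m => [_|m IH lt_mr] /=.
  by rewrite -[LHS](splitK i) /unsplit; case: (split i).
rewrite IH; last exact: ltnW.
rewrite permE /sigma_fun.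
case: (split i) => j.
  by rewrite (unsplitK (inl _)).
by rewrite (unsplitK (inr _)).
Qed.

Lemma val_sigma (r : nat) (i : 'I_(r + r)) :
  val (sigma r i) = if i < r then i.+1 %% r else r + (i - r).+1 %% r.
Proof.
rewrite permE /sigma_fun; case: (split_ordP i) => j -> //=.
by rewrite addKn.
Qed.

Lemma sigmaJphi (r : nat) : sigma r ^ phi r = (sigma r)^-1.
Proof.
apply: (mulgI (sigma r)); rewrite mulgV.
have phiV : (phi r)^-1 = phi r.
  by apply/eqP; rewrite eq_invg_mul -[_ * _]/(phi r ^+ 2) phi2.
rewrite conjgE phiV; apply/permP=> i; apply: val_inj.
rewrite !permM perm1 [phi r _]permE /= val_sigma permE /= val_sigma.
move: (nat_of_ord i) (ltn_ord i) => m lt_m {i}.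
have modS p : p < r -> p.+1 %% r = if p.+1 == r then 0 else p.+1.
  move=> lt_p; case: eqP => [->|/eqP ne]; first by rewrite modnn.
  by rewrite modn_small // ltn_neqAle ne.
case: (ltnP m r) => le_m; rewrite modS; try lia; case: eqP => e.
- by rewrite ifF ?modS; try lia; case: eqP; lia.
- by rewrite ifF ?modS; try lia; case: eqP; lia.
- by rewrite ifT ?modS; try lia; case: eqP; lia.
- by rewrite ifT ?modS; try lia; case: eqP; lia.
Qed.

Lemma elt_g_in_G (T : finGroupType) (r : nat) (a b : T) :
  elt_g r a b \in grpG T r.
Proof.
apply: groupM; first by apply: mem_gen; rewrite inE mem_morphim ?inE.
by apply: mem_gen; rewrite inE orbC mem_gen // set21.
Qed.

Lemma elt_g_notin_S (T : finGroupType) (r : nat) (a b : T) :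
  3 <= r -> elt_g r a b \notin grpS T r.
Proof.
move=> r3; apply/negP.
have valP x : (pair_of_sd (wr_perm T x)).1 = x :> 'S_(r + r).
  by rewrite val_insubd !inE.
case/cycleP=> n /(congr1 (fun u => (pair_of_sd u).1)).
rewrite /= !val_insubd !inE /= mul1g.
have -> : (pair_of_sd (elt_s T r ^+ n)).1 = phi r ^+ n.
  by rewrite /elt_s -morphX ?inE // valP.
have r0 : 0 < r + r by lia.
rewrite -(odd_double_half n) -mul2n expgD expgM phi2 expg1n mulg1.
move=> /permP/(_ (Ordinal r0))/(congr1 val); rewrite val_sigma /=.
rewrite modn_small; last lia.
have -> : 0 < r by lia.
by case: (odd n); rewrite ?perm1 ?permE /=; lia.
Qed.

Lemma grpS_proper (T : finGroupType) (r : nat) :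
  3 <= r -> grpS T r \proper grpG T r.
Proof.
move=> r3; apply/properP; split; last first.
  by exists (elt_g r 1 1); rewrite ?elt_g_in_G ?elt_g_notin_S.
by rewrite cycle_subG; apply: mem_gen; rewrite inE orbC mem_gen // set22.
Qed.

(* Main.v *)
Require Import Defs.
From mathcomp Require Import all_boot all_fingroup all_solvable.
From mathcomp Require Import zify.

Set Implicit Arguments.
Unset Strict Implicit.
Unset Printing Implicit Defensive.

Import GroupScope.

(** Write N = T^2r for the base group, s for the involution phi, and g for
    n sigma. Both conclusions concern the coset graph of G on S = <s>, and all
    the combinatorics follows from a few group-theoretic facts about s and g.

    Membership in OG(4). For an involution s and an element g generating G, the
    neighbours of the vertex S x are the cosets S g x, S g s x, S g^-1 x and
    S g^-1 s x. If s and g do not commute, g^2 <> 1 and (g s)^2 <> 1, these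
    are four distinct vertices, the action of G is faithful, and g^-1 lies
    outside S g S, so that no element of G reverses an arc
    (involution_coset_graph_OG4). Connectedness is the statement that s and g
    generate G.

    Generation (generate_grpG). Let B be the group of tuples lying in <s, g>.
    Since n is fixed by phi, the tuple c = (g s)^2 = n n^(sigma^-1) is in B;
    its entries are ab, b, 1, ..., 1, a on the first half and
    1, ..., 1, b, ba, a on the second. The entry of c at the first position
    and that of its conjugate by g^-1 are ab and a b a^-1, which generate T;
    as <sigma, phi> is transitive, B projects onto T at each position. By
    Goursat's argument a subgroup of T^k with full projections is all of T^k as
    soon as any two coordinates are separated by an element whose entries
    there have different orders (full_subdirect), and the orders of ab, a, b
    and 1 are distinct. By transitivity the first position and another one j
    suffice: c separates them unless j is the position of ba, and in that case
    the conjugate of c does, with entries of the orders of b and a.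

    Basic type. T being simple nonabelian and <sigma, phi> transitive on the
    factors, each nontrivial normal subgroup K of G contains N (wrN_min), and
    g^s g lies in N. So s inverts g modulo K, hence G = K S <g> and K-orbits on
    vertices are the cosets of L = K S, each represented by a power of g.
    Consecutive powers are adjacent, and there are no other adjacencies
    because L g L is the union of L g and L g^-1: the quotient is a cycle of
    length m, the least positive integer with g^m in L, degenerating to K_1 or
    K_2 when m < 3. The kernel on the K-orbits is the core of L in G, modulo
    which s and g generate a dihedral group of order 2m. The intersection of
    two such kernels is contained in each L, so its quotient has length a
    multiple of m, and is again a cycle. Finally N itself gives a cycle since
    neither g nor g^2 lies in N S. *)

(** * Coset graphs *)

Section CosetGraph.

Variables (gT : finGroupType) (G S : {group gT}) (g : gT).
Hypotheses (sSG : S \subset G) (Gg : g \in G).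

Let X := coset_graph G S g.

Lemma mem_dcosetM (t u d : gT) :
  t \in S -> u \in S -> (t * d * u \in S :* g * S) = (d \in S :* g * S).
Proof.
move=> St Su.
have mul v w e : v \in S -> w \in S -> e \in S :* g * S ->
    v * e * w \in S :* g * S.
  move=> Sv Sw /mulsgP[_ w' /rcosetP[v' Sv' ->] Sw' ->].
  rewrite !mulgA -[_ * w' * w]mulgA; apply: mem_mulg; last exact: groupM.
  by apply/rcosetP; exists (v * v'); rewrite ?groupM // !mulgA.
apply/idP/idP => [|Dd]; last exact: mul.
move/(mul t^-1 u^-1); rewrite !groupV => /(_ St Su).
by rewrite !mulgA mulVg mul1g mulgK.
Qed.

Lemma coset_adjE (x y : gT) : x \in G -> y \in G ->
  adj X (S :* x) (S :* y) =
    (x * y^-1 \in S :* g * S) || (y * x^-1 \in S :* g * S).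
Proof.
move=> Gx Gy; apply/existsP/idP => [[x' /andP[Gx' /existsP[y']]]|D].
  case/and4P=> Gy' /eqP/rcoset_eqP/rcosetP[t St ->].
  move=> /eqP/rcoset_eqP/rcosetP[u Su ->].
  have E v w : t * v * (u * w)^-1 = t * (v * w^-1) * u^-1.
    by rewrite invMg !mulgA.
  have E' v w : u * v * (t * w)^-1 = u * (v * w^-1) * t^-1.
    by rewrite invMg !mulgA.
  by rewrite E E' !mem_dcosetM ?groupV.
by exists x; rewrite Gx; apply/existsP; exists y; rewrite Gy !eqxx.
Qed.

Lemma coset_vsetP (A : {set gT}) :
  reflect (exists2 x, x \in G & A = S :* x) (A \in vset X).
Proof. exact: rcosetsP. Qed.

Lemma mem_coset_vset (x : gT) : x \in G -> S :* x \in vset X.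
Proof. by move=> Gx; apply/coset_vsetP; exists x. Qed.

Lemma coset_adjM (x y z : gT) : x \in G -> y \in G -> z \in G ->
  adj X (S :* (x * z)) (S :* (y * z)) = adj X (S :* x) (S :* y).
Proof.
by move=> Gx Gy Gz; rewrite !coset_adjE ?groupM // !invMg !mulgA !mulgK.
Qed.

Lemma coset_adjC : symmetric (adj X).
Proof.
have imp A B : adj X A B -> adj X B A.
  case/existsP=> x /andP[Gx /existsP[y /and4P[Gy eA eB adjAB]]].
  apply/existsP; exists y; rewrite Gy; apply/existsP; exists x.
  by rewrite Gx eA eB orbC.
by move=> A B; apply/idP/idP; apply: imp.
Qed.

Lemma coset_adj_vset A B : adj X A B -> (A \in vset X) && (B \in vset X).
Proof.
case/existsP=> x /andP[Gx /existsP[y /and4P[Gy /eqP-> /eqP-> _]]].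
by rewrite !mem_coset_vset.
Qed.

(** Translating by G brings each edge to the edge from S to S g, up to
    swapping its ends: this is edge-transitivity. *)
Lemma adj_coset_edge (A B : {set gT}) : adj X A B ->
  exists2 z, z \in G & [set A; B] = [set S :* z; S :* (g * z)].
Proof.
have step x y : x \in G -> y \in G -> x * y^-1 \in S :* g * S ->
    exists2 z, z \in G & S :* x = S :* (g * z) /\ S :* y = S :* z.
  move=> Gx Gy /mulsgP[_ u /rcosetP[t St ->] Su] /(canRL (mulgKV _)) ->.
  exists (u * y); first by rewrite groupM // (subsetP sSG).
  split; last by rewrite rcosetM (rcoset_id Su).
  by rewrite -!mulgA rcosetM (rcoset_id St).
case/existsP=> x /andP[Gx /existsP[y /and4P[Gy /eqP-> /eqP-> adjAB]]].
case/orP: adjAB => D.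
  by have [z Gz [-> ->]] := step _ _ Gx Gy D; exists z; rewrite // setUC.
by have [z Gz [-> ->]] := step _ _ Gy Gx D; exists z.
Qed.

Lemma coset_simple : g \notin S -> simple_graph X.
Proof.
move=> S'g; split=> [A B||A]; [exact: coset_adj_vset | exact: coset_adjC|].
apply/negbTE/negP=> adjA.
have /andP[/coset_vsetP[x Gx eA] _] := coset_adj_vset adjA.
move: adjA; rewrite eA coset_adjE // mulgV orbb.
case/mulsgP=> _ u /rcosetP[t St ->] Su /esym/(canRL (mulgK u)) tg.
case/negP: S'g; rewrite -(groupMl _ St) tg mul1g groupV //.
Qed.

Lemma adj_base : adj X S (S :* g).
Proof.
have := coset_adjE (group1 G) Gg; rewrite rcoset1 => ->; apply/orP; right.
by rewrite invg1 mem_mulg ?rcoset_refl ?group1.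
Qed.

(** The elements taking S into its own component form a group, because right
    multiplications are graph automorphisms; so generators suffice. *)
Lemma coset_connected : <<g |: S>> = G -> connected X.
Proof.
move=> genG.
have conn_sym := sym_connect_sym coset_adjC.
have connM z A B : z \in G -> connect (adj X) A B ->
    connect (adj X) (A :* z) (B :* z).
  move=> Gz /connectP[p]; elim: p A => [|C p IH] A /=; first by move=> _ ->.
  case/andP=> adjAC pathp lastB; apply: connect_trans (IH _ pathp lastB).
  apply: connect1; have /andP[] := coset_adj_vset adjAC.
  case/coset_vsetP=> x Gx eA /coset_vsetP[y Gy eC].
  by move: adjAC; rewrite eA eC -!rcosetM coset_adjM.
pose C := [set y in G | connect (adj X) S (S :* y)].
have gC : group_set C.
  apply/group_setP; split; first by rewrite inE group1 rcoset1 connect0.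
  move=> y z; rewrite !inE => /andP[Gy Cy] /andP[Gz Cz].
  by rewrite groupM //= (connect_trans Cz) // rcosetM connM.
have sGC : G \subset Group gC.
  rewrite -genG gen_subG subUset sub1set /= inE Gg /=; apply/andP; split.
    exact: connect1 adj_base.
  apply/subsetP=> t St; rewrite inE (subsetP sSG) // (rcoset_id St).
  by rewrite connect0.
move=> _ _ /coset_vsetP[x Gx ->] /coset_vsetP[y Gy ->].
have conn1 z : z \in G -> connect (adj X) S (S :* z).
  by move/(subsetP sGC); rewrite inE => /andP[].
by apply: connect_trans (conn1 y Gy); rewrite conn_sym conn1.
Qed.

Lemma coset_edges_trans : [transitive G, on edges X | 'Rs^*].
Proof.
apply/imsetP; exists [set S :* 1; S :* g].
  rewrite rcoset1; apply/imset2P; exists (gval S) (S :* g) => //.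
    by rewrite -[gval S]rcoset1 mem_coset_vset.
  by rewrite inE mem_coset_vset // adj_base.
have actE z : 'Rs^*%act [set S :* 1; S :* g] z = [set S :* z; S :* (g * z)].
  by rewrite /= /setact imsetU !imset_set1 /= !rcosetE -!rcosetM mul1g.
apply/setP=> E; apply/imset2P/imsetP.
  case=> A B _ /[!inE] /andP[_ adjAB] ->.
  by have [z Gz ->] := adj_coset_edge adjAB; exists z; rewrite ?actE.
case=> z Gz ->; rewrite actE; exists (S :* z) (S :* (g * z)) => //.
  by rewrite mem_coset_vset.
rewrite inE mem_coset_vset ?groupM // andTb.
have := coset_adjM (group1 G) Gg Gz; rewrite mul1g => ->.
by rewrite rcoset1 adj_base.
Qed.

(** An element z reversing the arc from S to S g has the form t g with t in S,
    and g t g lies in S; hence g^-1 lies in S g S. *)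
Lemma coset_arcs_not_trans :
  g^-1 \notin S :* g * S -> ~~ [transitive G, on arcs X | 'Rs * 2].
Proof.
move=> D'gV; apply/negP=> trG.
have arcP x y : x \in G -> y \in G -> adj X (S :* x) (S :* y) ->
    [tuple S :* x; S :* y] \in arcs X.
  move=> Gx Gy adjxy; apply/imset2P; exists (S :* x) (S :* y) => //.
    by rewrite mem_coset_vset.
  by rewrite inE mem_coset_vset.
have adj1g : adj X (S :* 1) (S :* g) by rewrite rcoset1 adj_base.
have arc1 := arcP _ _ (group1 G) Gg adj1g.
have arc2 : [tuple S :* g; S :* 1] \in arcs X.
  by rewrite arcP // coset_adjC.
have [z Gz] := atransP2 trG arc1 arc2.
move/(congr1 val) => [] /=; rewrite !rcosetE rcoset1 -rcosetM.
move/esym/rcoset_eqP=> /rcosetP[t St ->] eS.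
have Sgtg : g * (t * g) \in S by rewrite [gval S]eS rcoset_refl.
case/negP: D'gV.
have -> : g^-1 = t * g * (g * (t * g))^-1 by rewrite invMg mulKVg.
by rewrite mem_mulg ?groupV // mem_rcoset mulgK.
Qed.

Lemma coset_nbrP (x : gT) (A : {set gT}) : x \in G ->
  reflect (exists2 t, t \in S &
             A = S :* (g * t * x) \/ A = S :* (g^-1 * t * x))
          (adj X (S :* x) A).
Proof.
move=> Gx; apply: (iffP idP) => [adjxA | [t St eA]]; last first.
  have Gt := subsetP sSG t St.
  case: eA => ->; rewrite coset_adjE ?groupM ?groupV //; apply/orP.
    by right; rewrite mulgK mem_mulg ?rcoset_refl.
  left; rewrite !invMg invgK mulKVg -[_ * g]mulg1 mem_mulg //.
  by rewrite mem_rcoset mulgK groupV.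
have [y Gy eA] : exists2 y, y \in G & A = S :* y.
  by apply/coset_vsetP; case/andP: (coset_adj_vset adjxA).
move: adjxA; rewrite {}eA coset_adjE //.
case/orP=> /mulsgP[_ u /rcosetP[t St ->] Su].
  move=> e; have -> : y = u^-1 * (g^-1 * t^-1 * x).
    by rewrite -[LHS](mulgKV x) -[y * _]invgK invMg invgK e !invMg !mulgA.
  by exists t^-1; rewrite ?groupV //; right; rewrite rcosetM rcoset_id ?groupV.
move=> /(canRL (mulgKV _)) ->; exists u => //; left.
by rewrite -!mulgA rcosetM (rcoset_id St).
Qed.

End CosetGraph.

(** * Coset graphs of an involution *)
Section InvolutionCosetGraph.

Variables (gT : finGroupType) (G : {group gT}) (s g : gT).
Hypotheses (genG : <<[set s; g]>> = G) (os : #[s] = 2).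
Hypotheses (nc_sg : s ^ g != s) (g2 : g ^+ 2 != 1) (gs2 : (g * s) ^+ 2 != 1).

Let S := <[s]>%G.
Let X := coset_graph G S g.

Let Gs : s \in G. Proof. by rewrite -genG mem_gen ?set21. Qed.
Let Gg : g \in G. Proof. by rewrite -genG mem_gen ?set22. Qed.
Let sSG : S \subset G. Proof. by rewrite cycle_subG. Qed.

Let sV : s^-1 = s.
Proof. by apply/eqP; rewrite eq_invg_mul -[_ * _]/(s ^+ 2) -os expg_order. Qed.

Let nc_gs : g * s != s * g.
Proof. by apply: contra nc_sg => /eqP e; rewrite conjgE -e mulKg. Qed.

Let inS x : (x \in S) = (x == 1) || (x == s).
Proof. by rewrite /= cycle2g // !inE. Qed.

Let S'g : g \notin S.
Proof.
by rewrite inS; apply: contra nc_gs => /orP[] /eqP->; rewrite ?mul1g ?mulg1.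
Qed.

Let S'gg : g * g \notin S.
Proof.
rewrite inS; apply/norP; split; first exact: g2.
by apply: contra nc_gs => /eqP <-; rewrite mulgA.
Qed.

Let S'gsg : g * s * g \notin S.
Proof.
rewrite inS; apply/norP; split.
  apply: contra nc_gs => /eqP e.
  have gsV : g * s = g^-1 by apply/eqP; rewrite eq_mulgV1 invgK e.
  by rewrite gsV eq_invg_mul mulgA e.
apply: contra gs2 => /eqP e.
by rewrite -[_ ^+ 2]/(g * s * (g * s)) mulgA e -[s * s]/(s ^+ 2) -os expg_order.
Qed.

Let S'gsgV : g * s * g^-1 \notin S.
Proof.
have -> : g * s * g^-1 = s ^ g^-1 by rewrite conjgE invgK mulgA.
rewrite inS conjg_eq1 -order_eq1 os (canF_eq (conjgK _)) invgK [s == _]eq_sym.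
exact: nc_sg.
Qed.

Lemma involution_coset_nbrs x : x \in G ->
  [set A in vset X | adj X (S :* x) A] =
    [set S :* (g * x); S :* (g * s * x); S :* (g^-1 * x); S :* (g^-1 * s * x)].
Proof.
move=> Gx; apply/setP=> A; rewrite in_set.
have -> : (A \in vset X) && adj X (S :* x) A = adj X (S :* x) A.
  by apply: andb_idl => /coset_adj_vset /andP[].
apply/(coset_nbrP sSG Gg _ Gx)/idP.
  case=> t; rewrite inS => /orP[] /eqP-> [] ->;
    by rewrite ?mulg1 !inE eqxx ?orbT.
rewrite !inE -!orbA => /or4P[] /eqP->; [exists 1 | exists s | exists 1 | exists s];
  by rewrite ?mulg1 ?group1 ?inS ?eqxx ?orbT; auto.
Qed.

(** The three inequalities on s and g say that the four neighbours of a vertex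
    are distinct; together they also keep g^-1 out of S g S, and the first one
    makes S core-free. *)
Lemma involution_coset_graph_OG4 : OG4 'Rs X G.
Proof.
have D'gV : g^-1 \notin S :* g * S.
  apply/mulsgP=> [[_ u /rcosetP[t St ->] Su /eqP]].
  rewrite eq_invg_mul mulgA => /eqP e.
  move: St Su e; rewrite !inS => /orP[] /eqP-> /orP[] /eqP->;
    rewrite ?mul1g ?mulg1 ?mulgA => e.
  - by case/eqP: g2.
  - case/negP: S'gg; suff -> : g * g = s by rewrite inS eqxx orbT.
    by apply/eqP; rewrite eq_mulgV1 sV e.
  - by case/negP: S'gsg; rewrite e group1.
  - by case/eqP: gs2; rewrite -e expgS expg1 !mulgA.
split.
- exact: coset_simple.
- apply: coset_connected => //; apply/eqP; rewrite eqEsubset.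
  rewrite gen_subG subUset sub1set Gg sSG /= -genG genS //.
  by rewrite subUset !sub1set !inE inS !eqxx !orbT.
- move=> _ /coset_vsetP[x Gx ->]; rewrite involution_coset_nbrs //.
  have ne y z : y * z^-1 \notin S -> (S :* (y * x) == S :* (z * x)) = false.
    move=> S'yz; apply/negbTE/eqP=> /rcoset_eqP; rewrite mem_rcoset.
    by rewrite invMg mulgA mulgK (negbTE S'yz).
  rewrite -!setUA !cardsU1 cards1 !inE !ne //;
    rewrite ?invMg ?invgK ?sV ?mulgA //.
    by rewrite -mulgA -conjgE inS conjg_eq1 -order_eq1 os (negbTE nc_sg).
  by rewrite -[g * s * s]mulgA -[s * s]/(s ^+ 2) -os expg_order mulg1.
- split; first exact: actsRs_rcosets.
    apply/subsetP=> x; rewrite inE => /andP[Gx].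
    rewrite astabRs_rcosets => cx; have := subsetP (gcore_sub S G) x cx.
    rewrite inS inE => /orP[] // /eqP xs; case/negP: S'gsgV; rewrite -xs.
    have /bigcapP/(_ g Gg) := cx; rewrite mem_conjg.
    by rewrite conjgE invgK mulgA.
  move=> z Gz _ _ /coset_vsetP[x Gx ->] /coset_vsetP[y Gy ->].
  have actE u : 'Rs%act (S :* u) z = S :* (u * z) by rewrite /= rcosetE rcosetM.
  by rewrite -[LHS]/(adj X ('Rs%act _ _) ('Rs%act _ _)) !actE coset_adjM.
split; first exact: transRs_rcosets.
  exact: coset_edges_trans.
exact: coset_arcs_not_trans.
Qed.

End InvolutionCosetGraph.

(** * Normal quotients of coset graphs *)

(** An isomorphism onto Y is most easily given by a parametrization of X; the
    point w0 is the value of its inverse outside the vertex set. *)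
Lemma graph_iso_param (V W : finType) (X : graph V) (Y : graph W) (w0 : W)
    (h : W -> V) :
  vset Y = [set: W] -> injective h -> h @: [set: W] = vset X ->
  {mono h : i j / adj Y i j >-> adj X i j} -> graph_iso X Y.
Proof.
move=> vY inj_h imh adjh.
pose f A := odflt w0 [pick i | h i == A].
have hK : cancel h f.
  move=> i; rewrite /f; case: pickP => [j /eqP/inj_h // | /(_ i)].
  by rewrite eqxx.
have vP A : A \in vset X -> exists i, A = h i.
  by rewrite -imh => /imsetP[i _ ->]; exists i.
exists f; split.
- by move=> _ _ /vP[i ->] /vP[j ->]; rewrite !hK => ->.
- apply/setP=> i; rewrite vY inE; apply/imsetP; exists (h i); rewrite ?hK //.
  by rewrite -imh imset_f.
by move=> _ _ /vP[i ->] /vP[j ->]; rewrite !hK adjh.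
Qed.

Lemma graph_iso_card (V W : finType) (X : graph V) (Y : graph W) :
  graph_iso X Y -> #|vset X| = #|vset Y|.
Proof. by case=> f [inj_f <- _]; rewrite card_in_imset. Qed.

Lemma is_cycle_card (V : finType) (X : graph V) : is_cycle X -> 3 <= #|vset X|.
Proof. by case=> m m3 /graph_iso_card ->; rewrite cardsT card_ord. Qed.

Lemma cycle_valency (V : finType) (X : graph V) (x : V) :
  is_cycle X -> x \in vset X -> #|[set y in vset X | adj X x y]| <= 2.
Proof.
case=> m _ [f [inj_f _ adjf]] Xx.
set nbrs := [set y in _ | _].
have sub : f @: nbrs \subset [set ordS (f x); ord_pred (f x)].
  apply/subsetP=> _ /imsetP[y] /[!inE] /andP[Xy] adjxy ->.
  have := adjf x y Xx Xy; rewrite adjxy /= => /orP[] /eqP ->.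
    by rewrite eqxx.
  by rewrite ordSK eqxx orbT.
have <- : #|f @: nbrs| = #|nbrs|.
  apply: card_in_imset => y z /[!inE] /andP[Xy _] /andP[Xz _].
  exact: inj_f.
apply: leq_trans (subset_leq_card sub) _.
by rewrite cards2; case: eqP.
Qed.

(** The quotient by the trivial group is the graph itself, and valency tells it
    apart from a cycle. *)
Lemma trivial_quotient_not_cycle (aT : finGroupType) (V : finType)
    (to : {action aT &-> V}) (X : graph V) (x : V) :
  simple_graph X -> regular 4 X -> x \in vset X ->
  ~ is_cycle (normal_quotient to X 1).
Proof.
case=> adjX _ irrX reg4 Xx cyc.
have orb1 y : orbit to 1 y = [set y] by rewrite /orbit imset_set1 act1.
have orbX y : y \in vset X -> [set y] \in vset (normal_quotient to X 1).
  by move=> Xy; rewrite -orb1 imset_f.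
have := cycle_valency cyc (orbX x Xx); rewrite leqNgt => /negP[].
apply: (@leq_trans #|set1 @: [set y in vset X | adj X x y]|).
  by rewrite card_imset ?reg4 //; apply: set1_inj.
apply: subset_leq_card; apply/subsetP=> _ /imsetP[y] /[!inE] /andP[Xy adjxy] ->.
have ne_xy : [set x] != [set y].
  by rewrite (inj_eq set1_inj); apply: contraTneq adjxy => <-; rewrite irrX.
apply/and5P; split=> //; try exact: orbX.
apply/existsP; exists x; rewrite set11 /=.
by apply/existsP; exists y; rewrite set11.
Qed.

Lemma ordS_neq m (k : 'I_m) : 3 <= m -> k != ordS k.
Proof.
rewrite -(inj_eq val_inj) /=; case: k => k /= lt_km m3.
have [e | ne_km] := eqVneq k.+1 m; first by rewrite e modnn; lia.
by rewrite modn_small; lia.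
Qed.

Section DihedralQuotient.

Variables (gT : finGroupType) (G : {group gT}) (s g : gT).
Hypotheses (genG : <<[set s; g]>> = G) (os : #[s] = 2).

Let S := <[s]>%G.
Let X := coset_graph G S g.

Let Gs : s \in G. Proof. by rewrite -genG mem_gen ?set21. Qed.
Let Gg : g \in G. Proof. by rewrite -genG mem_gen ?set22. Qed.
Let sSG : S \subset G. Proof. by rewrite cycle_subG. Qed.

Let sV : s^-1 = s.
Proof. by apply/eqP; rewrite eq_invg_mul -[_ * _]/(s ^+ 2) -os expg_order. Qed.

(** The least m > 0 such that g^m lies in K S. When s inverts g modulo K,
    this is the number of K-orbits on vertices: <g> permutes them
    transitively, and the stabilizer of the orbit of S in <g> is the
    intersection of K S and <g>. *)
Definition quotient_length (K : {group gT}) : nat :=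
  #[coset ((K <*> S) :&: <[g]>) g].

Section OneQuotient.

Variable K : {group gT}.
Hypotheses (nKG : K <| G) (Kgsg : g ^ s * g \in K).

Let sKG : K \subset G := normal_sub nKG.
Let L := (K <*> S)%G.
Let m := quotient_length K.

Let sKL : K \subset L. Proof. exact: joing_subl. Qed.
Let sSL : S \subset L. Proof. exact: joing_subr. Qed.
Let sLG : L \subset G. Proof. by rewrite join_subG sKG sSG. Qed.
Let Ls : s \in L. Proof. by rewrite (subsetP sSL) // cycle_id. Qed.

Let nKS : S \subset 'N(K).
Proof. exact: subset_trans sSG (normal_norm nKG). Qed.

Let defL : L = K * S :> {set gT}.
Proof. by rewrite /= norm_joinEr. Qed.

Lemma quotient_length_gt0 : 0 < m.
Proof. exact: order_gt0. Qed.

Lemma expg_quotient_length (i j : nat) :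
  (g ^+ i \in L :* g ^+ j) = (i == j %[mod m]).
Proof.
set P := (L :&: <[g]>)%G.
have nPg k : g ^+ k \in 'N(P).
  apply: (subsetP (cents_norm (sub_abelian_cent (cycle_abelian g) _))).
    exact: subsetIr.
  exact: mem_cycle.
have nPg1 : g \in 'N(P) := nPg 1%N.
rewrite -eq_expg_mod_order -!morphX //.
apply/idP/eqP=> [|/rcoset_kercosetP-/(_ (nPg i) (nPg j))]; last first.
  by rewrite !mem_rcoset inE => /andP[].
rewrite mem_rcoset => Lij; apply/rcoset_kercosetP; rewrite ?nPg //.
by rewrite mem_rcoset inE Lij groupM ?groupV ?mem_cycle.
Qed.

(** Modulo K the element s normalizes <g>, so G is the product of S, K and
    <g>. *)
Lemma quotient_cover x : x \in G -> exists i, x \in L :* g ^+ i.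
Proof.
have nJs : S \subset 'N(K <*> <[g]>).
  rewrite cycle_subG inE joingE -genJ conjUg (normP (subsetP nKS s _)) ?cycle_id //.
  rewrite gen_subG subUset joing_subl /= -cycleJ cycle_subG.
  by rewrite -(mulgK g (g ^ s)) groupM // ?groupV ?mem_gen // inE ?Kgsg ?cycle_id ?orbT.
have nKg : <[g]> \subset 'N(K).
  by rewrite cycle_subG (subsetP (normal_norm nKG)).
have defG : G = L * <[g]> :> {set gT}.
  apply/eqP; rewrite eqEsubset mul_subG ?cycle_subG // andbT.
  rewrite defL -(normC nKS) -mulgA -norm_joinEr // -norm_joinEl // -genG.
  rewrite gen_subG subUset !sub1set !mem_gen //.
    by rewrite inE orbC mem_gen // inE cycle_id orbT.
  by rewrite inE /= cycle_id.
rewrite [in x \in _]defG => /mulsgP[l _ Ll /cycleP[i ->] ->].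
by exists i; rewrite mem_rcoset mulgK.
Qed.

Lemma quotient_vertexE x y : x \in G -> y \in G ->
  (orbit 'Rs K (S :* x) == orbit 'Rs K (S :* y)) = (x \in L :* y).
Proof.
move=> Gx Gy; apply/eqP/idP.
  move/orbit_eqP/orbitP => [k Kk]; rewrite /= rcosetE -rcosetM.
  move/esym/rcoset_eqP; rewrite !mem_rcoset => Sxyk.
  have -> : x * y^-1 = x * (y * k)^-1 * (k ^ y^-1).
    by rewrite conjgE invgK invMg !mulgA mulgKV mulgKV.
  rewrite groupM ?(subsetP sSL _ Sxyk) // (subsetP sKL) //.
  by rewrite memJ_norm // (subsetP (normal_norm nKG)) ?groupV.
rewrite mem_rcoset defL -(normC nKS) => /mulsgP[t k St Kk].
move/(canRL (mulgKV y)) => ->.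
apply/orbit_eqP/orbitP; exists (k ^ y).
  by rewrite memJ_norm // (subsetP (normal_norm nKG)).
by rewrite /= rcosetE -rcosetM -conjgC -mulgA [RHS]rcosetM (rcoset_id St).
Qed.

Let XK := normal_quotient 'Rs X K.
Let vtx i := orbit 'Rs K (S :* g ^+ i).

Let Ggi i : g ^+ i \in G. Proof. exact: groupX. Qed.

Let vtxE i j : (vtx i == vtx j) = (i == j %[mod m]).
Proof. by rewrite quotient_vertexE // expg_quotient_length. Qed.

Let vtx_in i : vtx i \in vset XK.
Proof. by rewrite imset_f ?mem_coset_vset. Qed.

Let vtx_onto A : A \in vset XK -> exists i, A = vtx i.
Proof.
case/imsetP=> _ /coset_vsetP[x Gx ->] ->.
have [i Lx] := quotient_cover Gx.
by exists i; apply/eqP; rewrite quotient_vertexE.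
Qed.

(** The step to a neighbour is insensitive to a factor s up to its direction,
    because g s lies in L g^-1 and g^-1 s in L g. *)
Let gs_step t x : t \in S -> x \in G ->
  (g * t * x \in L :* (g * x)) || (g * t * x \in L :* (g^-1 * x)) /\
  (g^-1 * t * x \in L :* (g * x)) || (g^-1 * t * x \in L :* (g^-1 * x)).
Proof.
rewrite [gval S]/= => St Gx; have /set2P[->|->] : t \in [set 1; s].
- by rewrite -cycle2g.
- by rewrite !mulg1 !rcoset_refl orbT.
have gsg : g * s * g \in L.
  have -> : g * s * g = s * (g ^ s * g).
    by rewrite conjgE sV !mulgA -[s * s]/(s ^+ 2) -os expg_order mul1g.
  by rewrite groupM // (subsetP sKL).
have gsgV : g^-1 * s * g^-1 \in L.
  by rewrite -groupV !invMg invgK sV mulgA.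
by rewrite !mem_rcoset !invMg !invgK !mulgA !mulgK gsg gsgV orbT.
Qed.

Lemma quotient_adjE i j :
  adj XK (vtx i) (vtx j) =
    (i != j %[mod m]) && ((j == i.+1 %[mod m]) || (i == j.+1 %[mod m])).
Proof.
rewrite -[LHS]/([&& vtx i \in vset XK, vtx j \in vset XK, vtx i != vtx j
  & [exists A in vtx i, exists B in vtx j, adj X A B]]).
rewrite !vtx_in vtxE !andTb; congr (_ && _); apply/existsP/idP; last first.
  have step k l : l == k.+1 %[mod m] ->
      [exists A in vtx k, exists B in vtx l, adj X A B].
    rewrite -vtxE => /eqP->; apply/existsP; exists (S :* g ^+ k).
    rewrite orbit_refl; apply/existsP; exists (S :* g ^+ k.+1).
    rewrite orbit_refl expgS andTb.
    have := coset_adjM S g (group1 G) Gg (Ggi k); rewrite mul1g => ->.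
    by rewrite rcoset1 adj_base.
  case/orP=> adjij; first exact: existsP (step _ _ adjij).
  have /existsP[A /andP[Aj /existsP[B /andP[Bi adjAB]]]] := step j i adjij.
  exists B; rewrite Bi; apply/existsP; exists A.
  by rewrite Aj coset_adjC.
case=> A /andP[Ai] /existsP[B /andP[Bj adjAB]].
have /orbitP[k Kk] := Ai; rewrite /= rcosetE -rcosetM => eA.
have Gk := subsetP sKG k Kk; have Gx := groupM (Ggi i) Gk.
have orbB : vtx j = orbit 'Rs K B by apply/esym/orbit_eqP.
have near e : e \in G ->
    orbit 'Rs K B == orbit 'Rs K (S :* (e * (g ^+ i * k))) ->
    e * g ^+ i \in L :* g ^+ j.
  move=> Ge; rewrite -orbB -quotient_vertexE ?groupM // -/(vtx j) => /eqP->.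
  apply/eqP/orbit_eqP/orbitP; exists k^-1; first by rewrite groupV.
  by rewrite /= rcosetE -rcosetM mulgA mulgK.
have [t St eB] : exists2 t, t \in S &
    B = S :* (g * t * (g ^+ i * k)) \/ B = S :* (g^-1 * t * (g ^+ i * k)).
  by apply/(coset_nbrP sSG Gg _ Gx); rewrite eA.
have Gt := subsetP sSG t St.
have : (g * g ^+ i \in L :* g ^+ j) || (g^-1 * g ^+ i \in L :* g ^+ j).
  have [step1 step2] := gs_step St Gx.
  by case: eB => eB; [case/orP: step1 | case/orP: step2] => step;
    apply/orP; [left|right|left|right]; apply: near; rewrite ?groupV // eB
      quotient_vertexE ?groupM ?groupV.
case/orP; first by rewrite -expgS expg_quotient_length eq_sym => ->.
have -> : g^-1 * g ^+ i = g ^+ i * g^-1.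
  by apply/esym/commuteV/commute_sym/commuteX.
rewrite mem_rcoset -mulgA -invMg -expgSr -mem_rcoset expg_quotient_length.
by move->; rewrite orbT.
Qed.

(** The adjacency required of Y covers at once the cycles and the degenerate
    lengths 1 and 2. *)
Let quotient_isoP (Y : graph 'I_m) : vset Y = [set: 'I_m] ->
    (forall i j : 'I_m,
      adj Y i j = (i != j) && ((j == ordS i) || (i == ordS j))) ->
  graph_iso XK Y.
Proof.
move=> vY adjY; have m0 := quotient_length_gt0.
have modE (i j : 'I_m) : (i == j %[mod m]) = (i == j).
  by rewrite !modn_small.
have modS (i j : 'I_m) : (i == j.+1 %[mod m]) = (i == ordS j).
  by rewrite modn_small.
apply: (graph_iso_param (Ordinal m0) (h := fun i : 'I_m => vtx i)) => //.
- by move=> i j /eqP; rewrite vtxE modE => /eqP.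
- apply/setP=> A; apply/imsetP/idP => [[i _ ->] | /vtx_onto[i ->]].
    exact: vtx_in.
  exists (Ordinal (ltn_pmod i m0)) => //.
  by apply/eqP; rewrite vtxE /= modn_mod.
by move=> i j; rewrite quotient_adjE adjY modE !modS.
Qed.

Lemma quotient_card : #|vset XK| = m.
Proof.
have iso : graph_iso XK (Graph [set: 'I_m]
    (fun i j => (i != j) && ((j == ordS i) || (i == ordS j)))).
  exact: quotient_isoP.
by rewrite (graph_iso_card iso) cardsT card_ord.
Qed.

Lemma quotient_iso_cycle : 3 <= m -> graph_iso XK (cycle_graph m).
Proof.
move=> m3; apply: quotient_isoP => // i j; rewrite /=.
have [<- | //] := eqVneq i j.
by rewrite (negbTE (ordS_neq i m3)).
Qed.

Lemma quotient_is_cycleP : reflect (is_cycle XK) (3 <= m).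
Proof.
apply: (iffP idP) => [m3 | /is_cycle_card]; last by rewrite quotient_card.
by exists m; last exact: quotient_iso_cycle.
Qed.

Lemma quotient_basic :
  [\/ graph_iso XK (complete_graph 1), graph_iso XK (complete_graph 2)
    | is_cycle XK].
Proof.
have [m3|] := ltnP 2 m; first by constructor 3; apply/quotient_is_cycleP.
move: quotient_isoP quotient_length_gt0; rewrite -/m.
case: m => [|[|[|]]] // iso _ _; [constructor 1 | constructor 2];
  apply: iso => // i j.
  by rewrite !ord1 eqxx.
by case: i j => [[|[|]] //] ? [[|[|]] //] ?.
Qed.

(** The K-orbits on vertices are permuted by G as the cosets of L. *)
Lemma quotient_kernel : orbits_kernel 'Rs X G K = gcore L G.
Proof.
have actE x y : x \in G -> y \in G ->
    'Rs^*%act (orbit 'Rs K (S :* y)) x = orbit 'Rs K (S :* (y * x)).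
  move=> Gx Gy; have Kx k : (k ^ x \in K) = (k \in K).
    by rewrite memJ_norm // (subsetP (normal_norm nKG)).
  apply/setP=> A; apply/imsetP/orbitP=> [[_ /orbitP[k Kk <-] ->] | [k Kk <-]].
    exists (k ^ x); first by rewrite Kx.
    by rewrite /= !rcosetE -!rcosetM -!mulgA -conjgC.
  exists (S :* (y * k ^ x^-1)).
    apply/orbitP; exists (k ^ x^-1); first by rewrite -Kx conjgKV.
    by rewrite /= rcosetE -rcosetM.
  by rewrite /= !rcosetE -!rcosetM conjgE invgK !mulgA mulgKV.
have sCG : gcore L G \subset G := subset_trans (gcore_sub _ _) sLG.
apply/setP=> x; apply/setIP/idP => [[Gx /astabP fix_x] | Cx].
  apply/bigcapP=> y Gy; rewrite mem_conjg conjgE invgK mulgA -mem_rcoset.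
  rewrite -quotient_vertexE ?groupM // -actE //; apply/eqP/fix_x.
  by rewrite imset_f ?mem_coset_vset.
have Gx := subsetP sCG x Cx; split=> //; apply/astabP.
move=> _ /imsetP[_ /coset_vsetP[y Gy ->] ->]; rewrite actE //.
apply/eqP; rewrite quotient_vertexE ?groupM // mem_rcoset.
by have /bigcapP/(_ y Gy) := Cx; rewrite mem_conjg conjgE invgK mulgA.
Qed.

(** Modulo the core of L, the images x of g and y of s satisfy the dihedral
    relations; x has order m, since a power of g in the core is in L, and y is
    not a power of x, since x^2 <> 1. *)
Lemma quotient_unoriented :
  3 <= m -> G / orbits_kernel 'Rs X G K \isog 'D_(m.*2).
Proof.
rewrite quotient_kernel => m3; set Q := gcore L G.
have nQG : Q <| G by apply: gcore_normal.
have nQx x : x \in G -> x \in 'N(Q) := subsetP (normal_norm nQG) x.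
have sKQ : K \subset Q by apply: gcore_max => //; exact: normal_norm.
have sQL : Q \subset L := gcore_sub _ _.
set x := coset Q g; set y := coset Q s.
have x_exp i : x ^+ i = 1 -> m %| i.
  rewrite -morphX ?nQx //= => /coset_idr; rewrite nQx // => /(_ isT) Qgi.
  rewrite /dvdn -(mod0n m) -expg_quotient_length mulg1.
  exact: subsetP sQL _ Qgi.
have xm : x ^+ m = 1.
  rewrite -morphX ?nQx //= coset_id //; apply/bigcapP=> z Gz.
  have [i] := quotient_cover Gz.
  case/rcosetP=> l Ll ->; rewrite conjsgM conjGid // mem_conjg conjXg.
  have -> : g ^ (g ^+ i)^-1 = g by apply/conjg_fixP/commgP/commuteV/commuteX.
  by have := expg_quotient_length m 0; rewrite expg0 rcoset1 modnn mod0n.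
have y2 : y ^+ 2 = 1 by rewrite -morphX ?nQx //= -os expg_order morph1.
have xy : x ^ y = x^-1.
  rewrite -morphJ ?nQx // -morphV ?nQx //; apply/rcoset_kercosetP.
  - by rewrite nQx ?groupJ.
  - by rewrite groupV nQx.
  by rewrite mem_rcoset invgK (subsetP sKQ).
have defGQ : G / Q = <[x]> <*> <[y]>.
  rewrite -genG quotient_gen; last by apply/subsetP=> z /set2P[] ->; apply: nQx.
  by rewrite quotientU !quotient_set1 ?nQx // setUC joing_idl joing_idr.
have nxy : <[y]> \subset 'N(<[x]>).
  by rewrite norms_cycle xy groupV cycle_id.
have ox : #[x] = m.
  by apply/eqP; rewrite eqn_dvd order_dvdn xm eqxx x_exp ?expg_order.
(* If y were a power of x, it would centralize x, forcing x^2 = 1. *)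
have x'y : y \notin <[x]>.
  apply: contraL m3 => /cycleP[i yx]; rewrite -leqNgt.
  apply: dvdn_leq => //; apply: x_exp; apply/eqP.
  by rewrite expgS -eq_invg_mul expg1 -xy yx conjgE -expgS expgSr mulKg.
have oy : #[y] = 2.
  apply: nt_prime_order => //; apply: contraNneq x'y => ->; exact: group1.
apply/(isoGrpP _ (Grp_dihedral (ltnW m3))); split.
  rewrite /= defGQ card_dihedral ?(ltnW m3) // norm_joinEr // TI_cardMg.
    by rewrite -!orderE ox oy muln2.
  rewrite setIC prime_TIg -?orderE ?oy //; apply: contra x'y.
  by rewrite cycle_subG.
rewrite /= defGQ; apply/existsP; exists (x, y); rewrite /= !xpair_eqE /=.
by rewrite xm y2 xy !eqxx.
Qed.

End OneQuotient.

Lemma quotient_length_dvd (K M : {group gT}) :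
  K \subset M <*> S -> quotient_length M %| quotient_length K.
Proof.
move=> sKM; set n := quotient_length K.
have /subsetP sub : K <*> S \subset M <*> S.
  by rewrite join_subG sKM joing_subr.
have gE (H : {group gT}) i : (g ^+ i \in H <*> S) = (quotient_length H %| i).
  by have := expg_quotient_length H i 0; rewrite expg0 rcoset1 mod0n.
by rewrite -gE sub // gE dvdnn.
Qed.

(** The hypothesis that g^s g belongs to all nontrivial normal subgroups makes
    the analysis above apply to all of them. Only the trivial one remains, and
    its quotient is 4-valent. *)
Lemma basic_unoriented_cycle_type_coset_graph :
    OG4 'Rs X G ->
    (forall K : {group gT}, K <| G -> K :!=: 1 -> g ^ s * g \in K) ->
    (exists N : {group gT}, [/\ N <| G, N :!=: 1 & 3 <= quotient_length N]) ->
  basic_unoriented_cycle_type 'Rs X G.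
Proof.
case=> simpX _ reg4 _ _ gsgK [N [nNG ntN N3]].
have cyc_nt (K : {group gT}) : cyclic_quotient 'Rs X G K -> K :!=: 1.
  case=> _ cycK; apply/eqP=> K1; move: cycK; rewrite K1.
  apply: (trivial_quotient_not_cycle simpX reg4 (x := S :* 1)).
  exact: mem_coset_vset.
have cycP (K : {group gT}) : cyclic_quotient 'Rs X G K ->
    [/\ K <| G, g ^ s * g \in K & 3 <= quotient_length K].
  move=> cycK; have [nKG cyc] := cycK; have gK := gsgK K nKG (cyc_nt K cycK).
  by split=> //; apply/quotient_is_cycleP.
split=> [K nKG ntK | | [M [M' [/cycP[nMG gM M3] /cycP[nM'G gM' _] []]]] | K].
- exact: quotient_basic (gsgK K nKG ntK).
- by exists N; split=> //; apply/quotient_is_cycleP; auto.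
  (* Both kernels are cores, so I lies in M S and its length is a multiple of
     that of M. *)
- pose I := (gcore (M <*> S) G :&: gcore (M' <*> S) G)%G.
  have sLG (K : {group gT}) : K <| G -> K <*> S \subset G.
    by move=> nKG; rewrite join_subG (normal_sub nKG).
  have nIG : I <| G by rewrite normalI ?gcore_normal ?sLG.
  have sub_core (K : {group gT}) : K <| G -> K \subset gcore (K <*> S) G.
    by move=> nKG; rewrite gcore_max ?joing_subl ?normal_norm.
  rewrite !quotient_kernel //; apply/(quotient_is_cycleP (K := I)) => //.
    by rewrite inE !(subsetP (sub_core _ _)).
  apply: leq_trans M3 (dvdn_leq (quotient_length_gt0 _) _).
  apply: quotient_length_dvd; apply: subset_trans (subsetIl _ _) _.
  exact: gcore_sub.
move=> /cycP[nKG gK K3]; exists (quotient_length K); split=> //.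
  exact: quotient_iso_cycle.
exact: quotient_unoriented.
Qed.

End DihedralQuotient.

(** * Powers of a nonabelian simple group *)
Section SimpleFacts.

Variable T : finGroupType.
Hypotheses (simT : simple [set: T]) (nabT : ~~ abelian [set: T]).

Lemma simple_perfect : [set: T]^`(1) = [set: T].
Proof.
have [_ /(_ _ (der_normal 1 [set: T]%G))] := simpleP _ simT.
case=> // der1.
by case/negP: nabT; apply/derG1P.
Qed.

Lemma simple_center_free (t : T) : (forall u, [~ t, u] = 1) -> t = 1.
Proof.
move=> cent_t; have [_ /(_ _ (center_normal [set: T]%G))] := simpleP _ simT.
case=> /= ZT.
  suff: t \in 'Z([set: T]) by rewrite ZT => /set1P.
  by apply/centerP; split=> // u _; apply/commgP/eqP.
by case/negP: nabT; rewrite -ZT center_abelian.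
Qed.

End SimpleFacts.

Section Power.

Variables (T : finGroupType) (k : nat).

Local Notation base := {dffun forall i : 'I_k, T}.

Local Notation single i t := (@dfung1 _ (fun _ : 'I_k => T) i t).
Local Notation coord i := (dffun_morphism (fun _ : 'I_k => T) i).

Lemma dfung1E i t j : single i t j = if j == i then t else 1.
Proof.
have [-> | ji] := eqVneq j i; first exact: dfung1_id.
by rewrite dfung1_dflt // eq_sym.
Qed.

Lemma baseJE (m m' : base) i : (m ^ m') i = m i ^ m' i.
Proof. by rewrite !conjgE !mulg_ffun invg_ffun. Qed.

Lemma baseRE (m m' : base) i : [~ m, m'] i = [~ m i, m' i].
Proof. by rewrite !commgEl mulg_ffun invg_ffun baseJE. Qed.

Lemma dfung1_gen (B : {group base}) :
  (forall i t, single i t \in B) -> B :=: setT.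
Proof.
move=> sB; apply/eqP; rewrite eqEsubset subsetT; apply/subsetP=> m _.
have -> : m = \prod_i single i (m i).
  apply/ffunP=> j; rewrite prodg_ffun (big_only1 j) ?dfung1_id // => i ij _.
  exact: dfung1_dflt.
exact: group_prod.
Qed.

Hypotheses (simT : simple [set: T]) (nabT : ~~ abelian [set: T]).

(** If m in B has a nontrivial entry at i, the elements [m i, u] with u in T
    are not all trivial, and each of them placed at i gives an element of B:
    it is a commutator of m. The simplicity of T then puts the whole factor at
    i in B, and transitivity the others. *)
Lemma normal_power (B : {group base}) :
    B <| setT -> B :!=: 1 ->
    (forall i j, exists x : 'S_k, x i = j /\
       forall m, m \in B -> base_act m x \in B) ->
  B :=: setT.
Proof.
move=> nB /trivgPn[m Bm m1] trB; apply: dfung1_gen.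
have [i mi] : exists i, m i != 1.
  apply/existsP; rewrite -negb_forall; apply: contra m1 => /forallP m1.
  by apply/eqP/ffunP=> i; rewrite oneg_ffun; apply/eqP.
have Bi t : single i t \in B.
  have [_ /(_ (@dfung1 _ (fun _ : 'I_k => T) i @*^-1 B)%G)] := simpleP _ simT.
  case.
  - rewrite /normal subsetT -(morphpreT ([morphism of @dfung1 _ (fun _ : 'I_k => T) i])).
    exact/morphpre_norms/normal_norm.
  - move=> /= B1; case/eqP: mi; apply: simple_center_free => // u.
    suff: [~ m i, u] \in @dfung1 _ (fun _ : 'I_k => T) i @*^-1 B.
      by rewrite B1 => /set1P.
    rewrite !inE /=.
    have -> : single i [~ m i, u] = [~ m, single i u].
      apply/ffunP=> j; rewrite baseRE !dfung1E; case: eqP => [-> //|_].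
      by rewrite commg1.
    by rewrite commgEl groupM ?groupV // memJ_norm // (subsetP (normal_norm nB)).
  by move/setP/(_ t); rewrite /= !inE.
move=> j t; have [x [<- Bx]] := trB i j.
have -> : single (x i) t = base_act (single i t) x.
  by apply/ffunP=> l; rewrite [RHS]ffunE !dfung1E (canF_eq (permKV x)).
exact: Bx.
Qed.

(** The image at i of the elements of B trivial at j is normal in T. If it were
    trivial, the kernels in B of the two coordinates would coincide, having
    the same order, and the entries at i and j of any element of B would have
    the same order. *)
Lemma kernel_separation (B : {group base}) i j :
    coord i @* B = setT -> coord j @* B = setT ->
    (exists2 m, m \in B & #[m i] != #[m j]) ->
  coord i @* ('ker_B (coord j)) = setT.
Proof.
move=> Bi Bj [m Bm om].
have [_ /(_ (coord i @* 'ker_B (coord j))%G)] := simpleP _ simT.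
case=> //= [|Ki].
  rewrite -[X in _ <| X]Bi; apply: morphim_normal.
  exact: normalGI (subsetT B) (ker_normal _).
have ker_card l : coord l @* B = setT -> (#|'ker_B (coord l)| * #|T|)%N = #|B|.
  move=> Bl; rewrite -[#|T|]cardsT -Bl card_morphim setTI.
  exact: LagrangeI.
have eq_ker : 'ker_B (coord j) = 'ker_B (coord i).
  apply/eqP; rewrite eqEcard; apply/andP; split.
    rewrite subsetI subsetIl /= -sub_morphim_pre ?subsetT // Ki //.
  by rewrite -(leq_pmul2r (cardG_gt0 [set: T])) cardsT !ker_card.
have dvd l l' : 'ker_B (coord l) = 'ker_B (coord l') -> #[m l'] %| #[m l].
  move=> e; have : m ^+ #[m l] \in 'ker_B (coord l).
    rewrite inE groupX //=; apply/kerP; rewrite ?inE // morphX ?inE //.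
    exact: expg_order.
  rewrite e inE => /andP[_ /mker]; rewrite morphX ?inE // => /eqP.
  by rewrite -order_dvdn.
by case/eqP: om; apply/eqP; rewrite eqn_dvd !dvd.
Qed.

(** A commutator of an element trivial on a set of positions and an element
    trivial at j is trivial on the union; as T is perfect, killing one more
    coordinate costs nothing at i. In the end B contains each factor. *)
Lemma full_subdirect (B : {group base}) :
    (forall i, coord i @* B = setT) ->
    (forall i j, i != j -> exists2 m, m \in B & #[m i] != #[m j]) ->
  B :=: setT.
Proof.
move=> projB sepB.
pose V (i : 'I_k) (l : seq 'I_k) (t : T) :=
  exists2 m, m \in B & m i = t /\ forall j, j \in l -> m j = 1.
have Vall i (l : seq 'I_k) : i \notin l -> forall t, V i l t.
  elim: l => [_ t|j l IH].
    have : t \in coord i @* B by rewrite projB.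
    by case/morphimP=> m _ Bm ->; exists m.
  rewrite inE negb_or => /andP[ij /IH Vl].
  pose K := [set t | [exists m in B,
    (m i == t) && all (fun j => m j == 1) (j :: l)]].
  have KP t : reflect (V i (j :: l) t) (t \in K).
    rewrite inE; apply: (iffP exists_inP) => [][m Bm].
      by case/andP=> /eqP mi /allP ml; exists m => //; split=> // j' /ml /eqP.
    case=> mi ml; exists m => //; rewrite mi eqxx; apply/allP=> j' /ml ->.
    exact: eqxx.
  have gK : group_set K.
    apply/group_setP; split.
      by apply/KP; exists 1; rewrite ?group1 //; split=> [|j' _]; rewrite oneg_ffun.
    move=> _ _ /KP[m Bm [<- ml]] /KP[m' Bm' [<- ml']]; apply/KP.
    exists (m * m'); rewrite ?groupM //; split=> [|j' lj']; rewrite mulg_ffun //.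
    by rewrite ml // ml' // mulg1.
  suff sTK : [set: T] \subset Group gK.
    by move=> t; apply/KP; rewrite (subsetP sTK).
  rewrite -simple_perfect // derg1 gen_subG.
  apply/subsetP=> _ /imset2P[t u _ _ ->].
  have [m Bm [mi ml]] := Vl t.
  have : u \in coord i @* 'ker_B (coord j).
    by rewrite (kernel_separation (projB i) (projB j) (sepB _ _ ij)).
  case/morphimP=> m' _ /setIP[Bm' /mker mj'] ->.
  apply/KP; exists [~ m, m']; first exact: groupR.
  split=> [|j']; rewrite baseRE ?mi // inE => /predU1P[->|/ml ->].
    by rewrite [m' j]mj' commg1.
  by rewrite comm1g.
apply: dfung1_gen => i t.
have [|m Bm [mi ml]] := Vall i [seq j <- enum 'I_k | j != i] _ t.
  by rewrite mem_filter eqxx.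
suff <- : m = single i t by [].
apply/ffunP=> j; rewrite dfung1E; case: eqP => [-> //|/eqP ji].
by rewrite ml // mem_filter ji mem_enum.
Qed.

End Power.

(** * Elements and normal subgroups of the wreath product *)
Section WreathElements.

Variables (T : finGroupType) (k : nat).

Local Notation base := {dffun forall i : 'I_k, T}.
Local Notation W := (wreath T k).
Local Notation single i t := (@dfung1 _ (fun _ : 'I_k => T) i t).

Definition wrN : {group W} := (sdpair1 (base_groupAction T k) @* setT)%G.

Lemma wr_baseM (m m' : base) : wr_base (m * m') = wr_base m * wr_base m'.
Proof. by rewrite /wr_base morphM ?inE. Qed.

Lemma wr_base1 : wr_base (1 : base) = 1.
Proof. exact: morph1. Qed.

Lemma wr_baseV (m : base) : wr_base m^-1 = (wr_base m)^-1.
Proof. by rewrite /wr_base morphV ?inE. Qed.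

Lemma wr_baseJ (m m' : base) : wr_base (m ^ m') = wr_base m ^ wr_base m'.
Proof. by rewrite !conjgE !wr_baseM wr_baseV. Qed.

Lemma wr_permM (x y : 'S_k) : wr_perm T (x * y) = wr_perm T x * wr_perm T y.
Proof. by rewrite /wr_perm morphM ?inE. Qed.

Lemma wr_perm1 : wr_perm T (1 : 'S_k) = 1.
Proof. exact: morph1. Qed.

Lemma wr_permV (x : 'S_k) : wr_perm T x^-1 = (wr_perm T x)^-1.
Proof. by rewrite /wr_perm morphV ?inE. Qed.

Lemma wr_permX (x : 'S_k) i : wr_perm T (x ^+ i) = wr_perm T x ^+ i.
Proof. by rewrite /wr_perm morphX ?inE. Qed.

Lemma wr_base_act (m : base) (x : 'S_k) :
  wr_base (base_act m x) = wr_base m ^ wr_perm T x.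
Proof. by rewrite /wr_base -sdpair_act ?inE. Qed.

Lemma wr_base_inj : injective (@wr_base T k).
Proof.
move=> m m'.
by apply: (injmP (injm_sdpair1 (base_groupAction T k))); rewrite inE.
Qed.

Lemma mem_wrN (m : base) : wr_base m \in wrN.
Proof. by rewrite mem_morphim ?inE. Qed.

Lemma wrNP w : reflect (exists m : base, w = wr_base m) (w \in wrN).
Proof.
by apply: (iffP morphimP) => [[m _ _ ->]|[m ->]]; exists m; rewrite ?inE.
Qed.

Lemma wr_permN (x : 'S_k) : (wr_perm T x \in wrN) = (x == 1).
Proof.
apply/idP/eqP=> [Nx | ->]; last by rewrite wr_perm1 group1.
have : wr_perm T x \in wrN :&: sdpair2 (base_groupAction T k) @* setT.
  by rewrite inE Nx mem_morphim ?inE.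
rewrite im_sdpair_TI => /set1P e.
by apply: (injmP (injm_sdpair2 (base_groupAction T k))); rewrite ?inE // morph1.
Qed.

Lemma wrP w : exists m : base, exists x : 'S_k, w = wr_base m * wr_perm T x.
Proof.
have : w \in sdpair1 (base_groupAction T k) @* setT *
             sdpair2 (base_groupAction T k) @* setT by rewrite im_sdpair inE.
by case/mulsgP=> _ _ /morphimP[m _ _ ->] /morphimP[x _ _ ->] ->; exists m, x.
Qed.

Lemma wrN_normal : wrN <| [set: W].
Proof. by have /sdprod_context[] := sdprod_sdpair (base_groupAction T k). Qed.


Lemma base_actJ (m u : base) (x : 'S_k) :
  wr_base m ^ (wr_base u * wr_perm T x) = wr_base (base_act (m ^ u) x).
Proof. by rewrite wr_base_act wr_baseJ conjgM. Qed.

Lemma base_actE (m : base) (x : 'S_k) i : base_act m x (x i) = m i.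
Proof. by rewrite ffunE permK. Qed.

(** wrN is the unique minimal normal subgroup: a nontrivial normal K meets it
    nontrivially, because an element moving the coordinate i does not commute
    with the base elements supported at i. *)
Lemma wrN_min (K : {group W}) :
    simple [set: T] -> ~~ abelian [set: T] ->
    wrN \subset 'N(K) -> K :!=: 1 ->
    (forall i j, exists x : 'S_k, x i = j /\ wr_perm T x \in 'N(K)) ->
  wrN \subset K.
Proof.
move=> simT nabT nKN ntK trK.
pose B := (sdpair1 (base_groupAction T k) @*^-1 K)%G.
have memB (m : base) : (m \in B) = (wr_base m \in K) by rewrite !inE.
suff BT : B :=: setT.
  apply/subsetP=> _ /wrNP[m ->]; by rewrite -memB BT inE.
have nK m : wr_base m \in 'N(K) := subsetP nKN _ (mem_wrN m).
apply: (normal_power simT nabT).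
- rewrite /normal subsetT; apply/subsetP=> u _; rewrite inE.
  apply/subsetP=> _ /imsetP[m Bm ->].
  by rewrite memB wr_baseJ memJ_norm // -memB.
- have [w Kw w1] := trivgPn _ ntK; have [m [x ew]] := wrP w.
  have [x1 | x1] := eqVneq x 1.
    apply/trivgPn; exists m.
      by rewrite memB; move: Kw; rewrite ew x1 wr_perm1 mulg1.
    apply: contraNneq w1 => m1; rewrite ew m1 x1 wr_perm1 mulg1.
    by rewrite wr_base1.
  have [i xi] : exists i, x i != i.
    apply/existsP; rewrite -negb_forall; apply: contra x1 => /forallP x1.
    by apply/eqP/permP=> i; rewrite perm1; apply/eqP.
  have [t _ t1] : exists2 t, t \in [set: T] & t != 1.
    apply/trivgPn; have /simpleP[] := simT.
    by [].
  apply/trivgPn; exists ((single i t)^-1 * base_act (single i t ^ m) x).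
    rewrite memB wr_baseM wr_baseV -base_actJ -ew -commgEl commgEr.
    by rewrite groupM // memJ_norm // groupV.
  apply: contra t1 => /eqP/ffunP/(_ i); rewrite mulg_ffun invg_ffun oneg_ffun.
  rewrite [base_act _ _ i]ffunE baseJE !dfung1E.
  rewrite eqxx -(inj_eq (@perm_inj _ x)) permKV eq_sym (negbTE xi) conj1g mulg1.
  by move/eqP; rewrite invg_eq1.
move=> i j; have [x [xij nKx]] := trK i j; exists x; split=> // m.
by rewrite !memB wr_base_act memJ_norm.
Qed.

End WreathElements.

(** * The permutations sigma and phi *)
Section Rotations.

Variable r : nat.
Hypothesis r3 : 3 <= r.

Let o0 : 'I_(r + r) := Ordinal (ltn_addl r (ltnW (ltnW r3))).

Lemma sigma_valE (i : 'I_(r + r)) :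
  val (sigma r i) = if i.+1 == r then 0 else if i.+1 == r + r then r else i.+1.
Proof.
rewrite val_sigma; have lt_i := ltn_ord i.
have modS p : p < r -> p.+1 %% r = if p.+1 == r then 0 else p.+1.
  move=> lt_p; case: eqP => [->|/eqP ne]; first by rewrite modnn.
  by rewrite modn_small // ltn_neqAle ne.
by case: ltnP => le_i; rewrite modS; try lia; case: eqP => e; do ?case: eqP; lia.
Qed.

Lemma sigmaX_ord0 j : j < r -> val ((sigma r ^+ j) o0) = j.
Proof.
elim: j => [|j IH] lt_j; first by rewrite perm1.
by rewrite expgSr permM sigma_valE IH; [case: eqP; [lia|]; case: eqP; lia | lia].
Qed.

Lemma sigma_last (i : 'I_(r + r)) :
  val i = (r + r).-2 -> val (sigma r i) = (r + r).-1.
Proof. by move=> ei; rewrite sigma_valE ei !ifF //; lia. Qed.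

Lemma sigma_phi_trans (i j : 'I_(r + r)) :
  exists2 x, x \in <<[set sigma r; phi r]>> & x i = j.
Proof.
have Ds : sigma r \in <<[set sigma r; phi r]>> by rewrite mem_gen ?set21.
have Dp : phi r \in <<[set sigma r; phi r]>> by rewrite mem_gen ?set22.
have from0 l : exists2 x, x \in <<[set sigma r; phi r]>> & x o0 = l.
  have [lt_l | le_l] := ltnP l r.
    exists (sigma r ^+ l); first exact: groupX.
    by apply: val_inj; rewrite sigmaX_ord0.
  exists (sigma r ^+ rev_ord l * phi r); first by rewrite groupM ?groupX.
  apply: val_inj; rewrite permM [phi r _]permE /= sigmaX_ord0 /=.
    by have := ltn_ord l; lia.
  by have := ltn_ord l; lia.
have [x Dx xi] := from0 i; have [y Dy yj] := from0 j.
exists (x^-1 * y); first by rewrite groupM ?groupV.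
by rewrite permM -xi permK yj.
Qed.

End Rotations.

(** * The elements s and g generate G *)
Section Generation.

Variables (r : nat) (T : finGroupType) (a b : T).
Hypothesis r3 : 3 <= r.

Local Notation base := {dffun forall i : 'I_(r + r), T}.

Local Notation coord i := (dffun_morphism (fun _ : 'I_(r + r) => T) i).

Let o0 : 'I_(r + r) := Ordinal (ltn_addl r (ltnW (ltnW r3))).

Let n : base := ntuple r a b.
Let s := elt_s T r.
Let g := elt_g r a b.

Let ntuple_phi : base_act n (phi r) = n.
Proof.
apply/ffunP=> i; rewrite -[i](permKV (phi r)) base_actE.
set j := (phi r)^-1 i; rewrite permE !ffunE !inE /=.
have := ltn_ord j; move: (nat_of_ord j) => m lt_m.
have -> : (r + r - m.+1 == 0) = (m == (r + r).-1) by lia.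
have -> : (r + r - m.+1 == (r + r).-1) = (m == 0) by lia.
have -> : (r + r - m.+1 == 1%N) = (m == (r + r).-2) by lia.
have -> : (r + r - m.+1 == (r + r).-2) = (m == 1%N) by lia.
by do 4!case: (m == _).
Qed.

(** The tuple equal to (g s)^2 in the wreath product. Its nontrivial entries
    are ab, b, a at the positions 0, 1, r - 1 and b, ba, a at the positions
    2r - 3, 2r - 2, 2r - 1. *)
Definition ctuple : base := n * base_act n (sigma r)^-1.

Let phiV : (phi r)^-1 = phi r.
Proof. by apply/eqP; rewrite eq_invg_mul -[_ * _]/(phi r ^+ 2) phi2. Qed.

Let sV : s^-1 = s.
Proof. by rewrite /s /elt_s -wr_permV phiV. Qed.

Lemma elt_gJs : g ^ s = wr_base n * wr_perm T (sigma r)^-1.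
Proof.
rewrite /g /elt_g conjMg -wr_base_act ntuple_phi; congr (_ * _).
by rewrite -sigmaJphi conjgE -sV /s /elt_s -!wr_permV -!wr_permM phiV.
Qed.

Lemma elt_gMJs : g * g ^ s = wr_base ctuple.
Proof.
rewrite elt_gJs /g /elt_g /ctuple wr_baseM wr_base_act conjgE -wr_permV invgK.
by rewrite !mulgA.
Qed.

Lemma elt_gs2 : (g * s) ^+ 2 = wr_base ctuple.
Proof.
by rewrite -elt_gMJs expgS expg1 conjgE sV !mulgA.
Qed.

Lemma ctupleE i : ctuple i = n i * n (sigma r i).
Proof. by rewrite mulg_ffun [base_act _ _ i]ffunE invgK. Qed.

Let n_a (i : 'I_(r + r)) : (val i == 0%N) || (val i == (r + r).-1) -> n i = a.
Proof. by move=> e; rewrite /n ffunE !inE e. Qed.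

Let n_b (i : 'I_(r + r)) : (val i == 1%N) || (val i == (r + r).-2) -> n i = b.
Proof. by move=> e; rewrite /n ffunE !inE e ifF //; move: e => /=; lia. Qed.

Let n_1 (i : 'I_(r + r)) : 1 < val i < (r + r).-2 -> n i = 1.
Proof. by move=> /= e; rewrite /n ffunE !inE !ifF //; lia. Qed.

Lemma ctuple_ord0 : ctuple o0 = a * b.
Proof.
by rewrite ctupleE n_a // n_b // -[sigma r]expg1 sigmaX_ord0 // ltnW.
Qed.

Lemma ctuple_1 i : val i = 1%N -> ctuple i = b.
Proof.
move=> i1; rewrite ctupleE n_b ?i1 // n_1 ?mulg1 // sigma_valE // i1.
by rewrite !ifF //; lia.
Qed.

Lemma ctuple_last i : val i = (r + r).-1 -> ctuple i = a.
Proof.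
move=> ei; rewrite ctupleE n_a ?ei ?eqxx ?orbT // n_1 ?mulg1 // sigma_valE // ei.
by rewrite ifF ?ifT //; lia.
Qed.

Lemma ctuple_other i : val i != 0%N -> val i != (r + r).-2 ->
  [\/ ctuple i = 1, ctuple i = a | ctuple i = b].
Proof.
move=> i0 i2; have lt_i := ltn_ord i.
have [i1 | i'1] := eqVneq (val i) 1%N; first by constructor 3; apply: ctuple_1.
have [il | i'l] := eqVneq (val i) (r + r).-1.
  by constructor 2; apply: ctuple_last.
have ni : n i = 1 by apply: n_1; move: i0 i2 i'1 i'l => /=; lia.
rewrite ctupleE ni mul1g.
have [e0 | ne0] := eqVneq i.+1 r.
  by constructor 2; apply: n_a; rewrite sigma_valE // e0 eqxx.
have ei : val (sigma r i) = i.+1.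
  by rewrite sigma_valE // (negbTE ne0) ifF //; move: i'l => /=; lia.
have [e2 | ne2] := eqVneq i.+1 (r + r).-2.
  by constructor 3; apply: n_b; rewrite ei e2 eqxx orbT.
by constructor 1; apply: n_1; rewrite ei; move: i0 i2 i'1 i'l ne2 => /=; lia.
Qed.

Let N := wrN T (r + r).

Let sNG : N \subset grpG T r := joing_subl _ _.
Let sDG : grpD T r \subset grpG T r := joing_subr _ _.

Lemma grpG_perm x : x \in <<[set sigma r; phi r]>> -> wr_perm T x \in grpG T r.
Proof.
have gP : group_set [set y | wr_perm T y \in grpG T r].
  apply/group_setP; split; first by rewrite inE wr_perm1 group1.
  by move=> y z; rewrite !inE wr_permM; apply: groupM.
move=> Dx; suff: x \in Group gP by rewrite inE.
apply: (subsetP _ x Dx); rewrite gen_subG subUset !sub1set !inE.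
by rewrite !(subsetP sDG) //; apply: mem_gen; rewrite ?set21 ?set22.
Qed.

Hypotheses (simT : simple [set: T]) (nabT : ~~ abelian [set: T]).
Hypotheses (genT : <<[set a; b]>> = [set: T]).
Hypotheses (oab : #[a * b] \notin [:: 1; #[a]; #[b]]%N) (neq_oab : #[a] != #[b]).

Let H := <<[set s; g]>>%G.

Let Hs : s \in H. Proof. by rewrite mem_gen ?set21. Qed.
Let Hg : g \in H. Proof. by rewrite mem_gen ?set22. Qed.

Let sHG : H \subset grpG T r.
Proof.
rewrite gen_subG subUset !sub1set elt_g_in_G andbT.
by rewrite (subsetP sDG) //; apply: mem_gen; rewrite set22.
Qed.

Let defG : grpG T r = N * H :> {set _}.
Proof.
have nNH : H \subset 'N(N).
  by apply: subset_trans (normal_norm (wrN_normal _ _)); apply: subsetT.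
have sHNH : H \subset N <*> H := joing_subr _ _.
apply/eqP; rewrite eqEsubset mul_subG // andbT -norm_joinEr //.
rewrite join_subG joing_subl gen_subG subUset !sub1set.
rewrite (subsetP sHNH _ Hs : wr_perm T (phi r) \in _) andbT.
have -> : wr_perm T (sigma r) = (wr_base n)^-1 * g by rewrite mulKg.
rewrite groupM ?groupV ?(subsetP sHNH g) //.
exact: (subsetP (joing_subl _ _) _ (mem_wrN _)).
Qed.

Let B := (sdpair1 (base_groupAction T (r + r)) @*^-1 H)%G.

Let memB (m : base) : (m \in B) = (wr_base m \in H).
Proof. by rewrite !inE. Qed.

(** As G = N H, each permutation in <sigma, phi> lifts to H at the cost of a
    base factor u, which changes entries only by conjugation. *)
Let transB i j : exists (u : base) (x : 'S_(r + r)),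
  x i = j /\ forall m, m \in B -> base_act (m ^ u) x \in B.
Proof.
have [x Dx xij] := sigma_phi_trans r3 i j.
have := grpG_perm Dx; rewrite defG => /mulsgP[_ h /wrNP[u ->] Hh e].
have eh : h = wr_base u^-1 * wr_perm T x by rewrite e wr_baseV mulKg.
exists u^-1, x; split=> // m; rewrite !memB -base_actJ -eh => Hm.
by rewrite groupJ.
Qed.

Let c := ctuple.

Let Bc : c \in B.
Proof. by rewrite memB -elt_gs2; apply/groupX/groupM. Qed.

(** The conjugate of c by g^-1, whose entries are conjugates of those of c one
    step further along sigma. *)
Let c' : base := base_act c (sigma r)^-1 ^ n^-1.

Let Bc' : c' \in B.
Proof.
rewrite memB wr_baseJ wr_base_act wr_permV wr_baseV -conjgM -invMg.
by rewrite groupJ ?groupV // -memB.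
Qed.

Let c'E i : c' i = c (sigma r i) ^ (n i)^-1.
Proof. by rewrite baseJE invg_ffun [base_act _ _ i]ffunE invgK. Qed.

Let sigma0 : val (sigma r o0) = 1%N.
Proof. by rewrite -[sigma r]expg1 sigmaX_ord0 // ltnW. Qed.

Let coord0_onto : coord o0 @* B = setT.
Proof.
apply/eqP; rewrite eqEsubset subsetT -genT gen_subG /=.
have mem m : m \in B -> m o0 \in coord o0 @* B.
  by move=> Bm; rewrite -[m o0]/(coord o0 m) mem_morphim // inE.
have Bab := mem _ Bc; rewrite ctuple_ord0 in Bab.
have := mem _ Bc'; rewrite c'E (ctuple_1 sigma0) n_a // => Baba.
have Ba : a \in coord o0 @* B.
  have -> : a = (b ^ a^-1)^-1 * (a * b).
    by rewrite conjgE invgK !invMg invgK !mulgA !mulgKV.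
  by rewrite groupM // groupV.
by rewrite subUset !sub1set Ba -(groupMl _ Ba).
Qed.

Let coord_onto i : coord i @* B = setT.
Proof.
have [u [x [x0i BxB]]] := transB o0 i.
apply/eqP; rewrite eqEsubset subsetT; apply/subsetP=> t _.
have : t ^ (u o0)^-1 \in coord o0 @* B by rewrite coord0_onto inE.
case/morphimP=> m _ Bm /(canRL (conjgKV _)) ->; apply/morphimP.
exists (base_act (m ^ u) x); rewrite ?in_setT ?BxB //.
by rewrite -[RHS]/(base_act (m ^ u) x i) -x0i base_actE baseJE.
Qed.

(** The entry ab of c at 0 shares its order only with the entry ba at 2r - 2;
    there c' has a conjugate of a, against a conjugate of b at 0. *)
Let separated0 j : j != o0 -> exists2 m, m \in B & #[m o0] != #[m j].
Proof.
move=> j0; have [j2 | j'2] := eqVneq (val j) (r + r).-2.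
  exists c' => //; rewrite !c'E !orderJ (ctuple_1 sigma0) eq_sym.
  by rewrite ctuple_last // sigma_last.
exists c => //; rewrite ctuple_ord0; apply: contraNneq oab => ->.
have [||->|->|->] := @ctuple_other j; rewrite ?order1 ?inE ?eqxx ?orbT //.
Qed.

Let separated i j : i != j -> exists2 m, m \in B & #[m i] != #[m j].
Proof.
move=> ij; have [u [x [x0i BxB]]] := transB o0 i.
have [|m Bm om] := @separated0 (x^-1 j).
  by apply: contra ij => /eqP e; rewrite -x0i -e permKV eqxx.
exists (base_act (m ^ u) x); first exact: BxB.
by rewrite -x0i -[j](permKV x) !base_actE !baseJE !orderJ.
Qed.

Lemma generate_grpG : <<[set s; g]>> = grpG T r.
Proof.
have BT : B :=: setT := full_subdirect simT nabT coord_onto separated.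
apply/eqP; rewrite eqEsubset sHG defG mul_subG //.
by apply/subsetP=> _ /wrNP[m ->]; rewrite -memB BT inE.
Qed.

End Generation.

(** * The quotient by the base group *)
Section QuotientByBase.

Variables (r : nat) (T : finGroupType) (a b : T).
Hypothesis r3 : 3 <= r.

Let s := elt_s T r.
Let g := elt_g r a b.
Let N := grpN T r.
Let o0 : 'I_(r + r) := Ordinal (ltn_addl r (ltnW (ltnW r3))).

Let g_wr i : exists m, g ^+ i = wr_base m * wr_perm T (sigma r ^+ i).
Proof.
elim: i => [|i [m IH]]; first by exists 1; rewrite wr_base1 wr_perm1 mul1g.
rewrite expgSr IH expgSr wr_permM; set x := wr_perm T _.
exists (m * base_act (ntuple r a b) (sigma r ^+ i)^-1).
by rewrite wr_baseM wr_base_act wr_permV -/x conjgE invgK !mulgA mulgKV.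
Qed.

Lemma order_elt_s : #[s] = 2.
Proof.
apply: nt_prime_order => //; first by rewrite /s /elt_s -wr_permX phi2 wr_perm1.
apply/eqP=> s1; have : wr_perm T (phi r) \in N by rewrite [wr_perm _ _]s1 group1.
rewrite wr_permN => /eqP/permP/(_ o0)/(congr1 val); rewrite perm1 permE /=.
by clear -r3; lia.
Qed.

(** Modulo N the claim is that sigma^i is neither 1 nor phi, which is seen on
    the image of the position 0: it is i, whereas 1 and phi send 0 to 0 and
    2r - 1. *)
Lemma elt_g_exp i : 0 < i < r -> g ^+ i \notin N <*> grpS T r.
Proof.
case/andP=> i0 lt_i; have [m ->] := g_wr i.
have Nm : wr_base m \in N := mem_wrN m.
have sNL : N \subset N <*> grpS T r := joing_subl _ _.
have nNS : grpS T r \subset 'N(N).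
  exact: subset_trans (subsetT _) (normal_norm (wrN_normal _ _)).
rewrite (groupMl _ (subsetP sNL _ Nm)) /= norm_joinEr //.
apply/mulsgP=> [[_ _ /wrNP[u ->] /cycleP[j ->]]].
have -> : elt_s T r ^+ j = wr_perm T (phi r ^+ j) by rewrite wr_permX.
move/esym/(canRL (mulgK _)) => eu.
have : wr_perm T (sigma r ^+ i * (phi r ^+ j)^-1) \in N.
  by rewrite wr_permM wr_permV -eu mem_wrN.
rewrite wr_permN -eq_mulgV1 => /eqP/permP/(_ o0)/(congr1 val).
rewrite sigmaX_ord0 // -(odd_double_half j) -mul2n expgD expgM phi2 expg1n mulg1.
by case: (odd j); rewrite ?perm1 ?permE /=; lia.
Qed.

(** This is the conjugate by g of g g^s = (g s)^2. *)
Lemma elt_gJs_mul : g ^ s * g \in N.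
Proof.
have -> : g ^ s * g = (g * g ^ s) ^ g.
  by apply: (mulgI g); rewrite [X in _ = _ * X]conjgE mulKVg mulgA.
have nNg : g \in 'N(N) by rewrite (subsetP (normal_norm (wrN_normal _ _))) ?inE.
by rewrite memJ_norm // elt_gMJs //; exact: (mem_wrN _).
Qed.

End QuotientByBase.

Theorem lemma7p11 (r : nat) (T : finGroupType) (a b : T) :
  3 <= r ->
  simple [set: T] -> ~~ abelian [set: T] ->
  <<[set a; b]>> = [set: T] ->
  #[a] = 2 -> 3 <= #[b] ->
  #[a * b] <> #[a] -> #[a * b] <> #[b] ->
  #[b * a] <> #[a] -> #[b * a] <> #[b] ->
  OG4 'Rs (Gamma r a b) (grpG T r) /\
  basic_unoriented_cycle_type 'Rs (Gamma r a b) (grpG T r).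
Proof.
move=> r3 simT nabT genT oa ob oab_a oab_b _ _.
set s := elt_s T r; set g := elt_g r a b.
(* ab = 1 would give b = a^-1 the order 2. *)
have ab1 : a * b != 1.
  by apply: contraTneq ob => /eqP; rewrite -eq_invg_mul => /eqP <-; rewrite orderV oa.
have oab : #[a * b] \notin [:: 1; #[a]; #[b]]%N.
  rewrite !inE order_eq1 (negbTE ab1) /=.
  by apply/norP; split; apply/eqP.
have neq_oab : #[a] != #[b] by rewrite oa; lia.
have genG := generate_grpG r3 simT nabT genT oab neq_oab.
have os : #[s] = 2 := order_elt_s T r3.
have N_gs2 : (g * s) ^+ 2 \in grpN T r by rewrite elt_gs2 //; exact: (mem_wrN _).
have L'g2 : g ^+ 2 \notin grpN T r <*> grpS T r by rewrite elt_g_exp.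
have g2 : g ^+ 2 != 1 by apply: contraNneq L'g2 => ->; apply: group1.
have nc_sg : s ^ g != s.
  (* If s and g commute, then g^2 = (g s)^2 lies in the base group. *)
  apply: contra L'g2 => /eqP sg; apply: (subsetP (joing_subl _ _)).
  have cgs : commute g s by apply/commute_sym/commgP/conjg_fixP.
  by move: N_gs2; rewrite expgMn // -{2}os expg_order mulg1.
have gs2 : (g * s) ^+ 2 != 1.
  rewrite elt_gs2 // -wr_base1 (inj_eq (@wr_base_inj _ _)).
  apply: contra ab1 => /eqP/ffunP/(_ (Ordinal (ltn_addl r (ltnW (ltnW r3))))).
  by rewrite ctuple_ord0 oneg_ffun => ->.
have OG := involution_coset_graph_OG4 genG os nc_sg g2 gs2.
split; first exact: OG.
have sNK (K : {group wreath T (r + r)}) :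
    K <| grpG T r -> K :!=: 1 -> grpN T r \subset K.
  move=> nKG ntK; have nK := subsetP (normal_norm nKG).
  apply: (wrN_min simT nabT) => // [|i j].
    exact: subset_trans (joing_subl _ _) (normal_norm nKG).
  have [x Dx xij] := sigma_phi_trans r3 i j.
  by exists x; split=> //; apply/nK/grpG_perm.
apply: (basic_unoriented_cycle_type_coset_graph genG os OG) => [K nKG ntK|].
  apply: (subsetP (sNK K nKG ntK)).
  exact: elt_gJs_mul.
have nNG : grpN T r <| grpG T r.
  rewrite /normal joing_subl (subset_trans (subsetT _)) //.
  exact: normal_norm (wrN_normal _ _).
exists (grpN T r); split=> //.
  by apply: contraTneq N_gs2 => ->; rewrite inE.
rewrite leqNgt; apply/negP=> lt3; set m := quotient_length s g (grpN T r) in lt3.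
have /negP[] : g ^+ m \notin grpN T r <*> grpS T r.
  by rewrite elt_g_exp // quotient_length_gt0 (leq_trans lt3).
have := expg_quotient_length s g (grpN T r) m 0.
by rewrite expg0 rcoset1 modnn mod0n eqxx.
Qed.
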